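(* There exists a nontrivial line segment $\mathcal L\subset\mathbb R^3$ which contains a badly approximable vector and such that every point of $\mathcal L$ admits an improvement in Dirichlet's theorem, i.e. every $\mathbf v\in\mathcal L$ belongs to $\mathrm{DI}(\sigma)$ for some $\sigma=\sigma(\mathbf v)\in(0,1)$.
   Context: $\|\cdot\|$ is the sup-norm on $\mathbb R^3$. For $\sigma\in(0,1)$, $\mathbf v\in\mathbb R^3$ belongs to $\mathrm{DI}(\sigma)$ if for all sufficiently large $Q$ there exist $q\in\mathbb N$, $\mathbf p\in\mathbb Z^3$ with $\|q\mathbf v-\mathbf p\|<\sigma Q^{-1/3}$ and $q<\sigma Q$. $\mathbf v$ is badly approximable if there is $c>0$ with $\|q\mathbf v-\mathbf p\|\ge c\,q^{-1/3}$ for all $q\in\mathbb N$, $\mathbf p\in\mathbb Z^3$. *)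

(* Defs.v *)
From Stdlib Require Import Reals ZArith.
Open Scope R_scope.

Definition vec3 := (R * R * R)%type.

Definition v1 (v : vec3) : R := fst (fst v).
Definition v2 (v : vec3) : R := snd (fst v).
Definition v3 (v : vec3) : R := snd v.

Definition supnorm (v : vec3) : R :=
  Rmax (Rabs (v1 v)) (Rmax (Rabs (v2 v)) (Rabs (v3 v))).

Definition approx_err (q : nat) (v : vec3) (p : Z * Z * Z) : R :=
  supnorm ((INR q * v1 v - IZR (fst (fst p)),
            INR q * v2 v - IZR (snd (fst p))),
            INR q * v3 v - IZR (snd p)).

Definition DI (sigma : R) (v : vec3) : Prop :=
  exists Q0 : R, forall Q : R, Q0 <= Q -> 0 < Q ->
    exists (q : nat) (p : Z * Z * Z),
      (1 <= q)%nat /\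
      approx_err q v p < sigma * Rpower Q (-(1/3)) /\
      INR q < sigma * Q.

Definition badly_approximable (v : vec3) : Prop :=
  exists c : R, 0 < c /\
    forall (q : nat) (p : Z * Z * Z), (1 <= q)%nat ->
      c * Rpower (INR q) (-(1/3)) <= approx_err q v p.

Definition segment_point (a b : vec3) (t : R) : vec3 :=
  ((v1 a + t * (v1 b - v1 a), v2 a + t * (v2 b - v2 a)), v3 a + t * (v3 b - v3 a)).

Definition in_segment (a b v : vec3) : Prop :=
  exists t : R, 0 <= t <= 1 /\ v = segment_point a b t.

(* Main.v *)
(* The segment lies on the line of points v(s) = (sqrt 2, s, s sqrt 2).  The vector (1, v(s)) is
   an eigenvector, with eigenvalue sqrt 2, of an integer matrix.

   Suppose that no 0 < q < n brings q v within d of an integer point, where n d^3 is nearly 1.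
   Then the cubes of side d based at the points q v, q < n, are disjoint in the torus and
   nearly fill it, so that every nontrivial Fourier coefficient of the union of the cubes is
   small.  At an integer vector m with |m_i| d <= 1/2 this coefficient is comparable with
   sin (PI x) / x, where x = n (m0 + m.v).  Hence x is close to a nonzero integer for each
   such m for which x is bounded.  By the pigeonhole principle there is such an m, and the
   transposed matrix maps it to another one, with sqrt 2 x in place of x.  But x and sqrt 2 x
   cannot both be close to nonzero integers, since sqrt 2 is irrational.

   The torus is replaced by a grid (Z/N)^3 with N large, and v by the rational point V/N.

   At s = sqrt 3 the coordinates of (1, v) form a basis of the field Q(sqrt 2, sqrt 3), so v is
   badly approximable because nonzero algebraic integers have norm at least 1. *)

Require Import Defs.
From Stdlib Require Import Reals ZArith Znumtheory List Lia Lra Classical FinFun.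
Open Scope R_scope.

(** * Sums over lists, the pigeonhole principle and integer grids *)

Definition lsum {A : Type} (f : A -> R) (l : list A) : R :=
  fold_right Rplus 0 (map f l).

Lemma lsum_app {A} (f : A -> R) l l' : lsum f (l ++ l') = lsum f l + lsum f l'.
Proof.
  induction l as [|x l IH]; unfold lsum in *; simpl; [lra|].
  rewrite IH; lra.
Qed.

Lemma lsum_ext {A} (f g : A -> R) l :
  (forall x, In x l -> f x = g x) -> lsum f l = lsum g l.
Proof.
  intros H; unfold lsum; f_equal; now apply map_ext_in.
Qed.

Lemma lsum_map {A B} (f : B -> R) (h : A -> B) l :
  lsum f (map h l) = lsum (fun x => f (h x)) l.
Proof. unfold lsum; now rewrite map_map. Qed.

Lemma lsum_scal {A} (c : R) (f : A -> R) l :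
  lsum (fun x => c * f x) l = c * lsum f l.
Proof.
  induction l as [|x l IH]; unfold lsum in *; simpl; [lra|].
  rewrite IH; lra.
Qed.

Lemma lsum_one_minus {A} (f : A -> R) l :
  lsum (fun x => 1 - f x) l = INR (length l) - lsum f l.
Proof.
  induction l as [|x l IH]; [unfold lsum; simpl; lra|].
  change (length (x :: l)) with (S (length l)); rewrite S_INR.
  unfold lsum in *; simpl; rewrite IH; lra.
Qed.

Lemma lsum_list_prod {A B} (f : A * B -> R) l l' :
  lsum f (list_prod l l') = lsum (fun x => lsum (fun y => f (x, y)) l') l.
Proof.
  induction l as [|x l IH]; [reflexivity|].
  simpl list_prod; rewrite lsum_app, IH, lsum_map; reflexivity.
Qed.

Lemma lsum_incl {A} (f : A -> R) l l' :
  NoDup l -> incl l l' -> (forall x, 0 <= f x) -> lsum f l <= lsum f l'.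
Proof.
  intros Hl; revert l'; induction Hl as [|x l Hx Hl IH]; intros l' Hi Hf.
  - clear Hi; induction l' as [|x l' IH]; unfold lsum in *; simpl in *; [lra|].
    specialize (Hf x); lra.
  - destruct (in_split x l') as (l1 & l2 & ->); [apply Hi; now left|].
    assert (H : lsum f l <= lsum f (l1 ++ l2)).
    { apply IH; [|exact Hf].
      intros y Hy; specialize (Hi y (or_intror Hy)).
      apply in_or_app; apply in_app_or in Hi as [Hi|[Hi|Hi]]; auto.
      subst; contradiction. }
    rewrite lsum_app in *; unfold lsum in *; simpl; lra.
Qed.

Lemma NoDup_list_prod {A B} (l : list A) (l' : list B) :
  NoDup l -> NoDup l' -> NoDup (list_prod l l').
Proof.
  intros Hl Hl'; induction Hl as [|x l Hx Hl IH]; simpl; [constructor|].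
  apply NoDup_app; [|exact IH|].
  - apply Injective_map_NoDup; [intros u w; congruence|exact Hl'].
  - intros [u w] H1 H2; apply in_map_iff in H1 as (y & E & _); inversion E; subst.
    apply in_prod_iff in H2; tauto.
Qed.

Lemma NoDup_map_inj {A B} (f : A -> B) l :
  NoDup l -> (forall x y, In x l -> In y l -> f x = f y -> x = y) -> NoDup (map f l).
Proof.
  intros Hl Hf; apply NoDup_map_NoDup_ForallPairs; [|exact Hl].
  intros x y Hx Hy; now apply Hf.
Qed.

Lemma pigeonhole {A B} (f : A -> B) l l' :
  NoDup l -> incl (map f l) l' -> (length l' < length l)%nat ->
  exists x y, In x l /\ In y l /\ x <> y /\ f x = f y.
Proof.
  intros Hl Hi Hlen; apply NNPP; intros H.
  assert (N : NoDup (map f l)).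
  { apply NoDup_map_inj; [exact Hl|].
    intros x y Hx Hy E; apply NNPP; intros Hne; apply H; now exists x, y. }
  apply NoDup_incl_length with (l' := l') in N; [|exact Hi].
  rewrite length_map in N; lia.
Qed.

Definition zrange (n : nat) : list Z := map Z.of_nat (seq 0 n).

Lemma in_zrange n z : In z (zrange n) <-> (0 <= z < Z.of_nat n)%Z.
Proof.
  unfold zrange; rewrite in_map_iff; split.
  - intros (k & <- & Hk); apply in_seq in Hk; lia.
  - intros H; exists (Z.to_nat z); rewrite in_seq; lia.
Qed.

Lemma NoDup_zrange n : NoDup (zrange n).
Proof.
  apply Injective_map_NoDup; [intros x y; lia|apply seq_NoDup].
Qed.

Lemma length_zrange n : length (zrange n) = n.
Proof. unfold zrange; now rewrite length_map, length_seq. Qed.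

Lemma lsum_zrange_S (f : Z -> R) n :
  lsum f (zrange (S n)) = lsum f (zrange n) + f (Z.of_nat n).
Proof.
  unfold zrange; rewrite seq_S, map_app, lsum_app; unfold lsum; simpl; lra.
Qed.

Definition grid (n : nat) : list (Z * Z * Z) :=
  list_prod (list_prod (zrange n) (zrange n)) (zrange n).

Lemma in_grid n x y z :
  In (x, y, z) (grid n) <->
  (0 <= x < Z.of_nat n)%Z /\ (0 <= y < Z.of_nat n)%Z /\ (0 <= z < Z.of_nat n)%Z.
Proof. unfold grid; rewrite !in_prod_iff, !in_zrange; tauto. Qed.

Lemma NoDup_grid n : NoDup (grid n).
Proof. repeat apply NoDup_list_prod; apply NoDup_zrange. Qed.

Lemma length_grid n : length (grid n) = (n * n * n)%nat.
Proof. unfold grid; now rewrite !length_prod, length_zrange. Qed.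

(** * Trigonometric sums *)

Lemma cos_period_Z x k : cos (x + 2 * IZR k * PI) = cos x.
Proof.
  destruct (Z_le_gt_dec 0 k) as [H|H].
  - rewrite <- (Z2Nat.id k H), <- INR_IZR_INZ; apply cos_period.
  - rewrite <- (cos_period (x + 2 * IZR k * PI) (Z.to_nat (- k))).
    f_equal; rewrite INR_IZR_INZ, Z2Nat.id, opp_IZR by lia; ring.
Qed.

Lemma Rabs_sin_shift x k : Rabs (sin (x - IZR k * PI)) = Rabs (sin x).
Proof.
  rewrite sin_minus, (sin_eq_0_1 (IZR k * PI)) by now exists k.
  assert (H : Rabs (cos (IZR k * PI)) = 1).
  { rewrite <- Rabs_R1; apply Rsqr_eq_abs_0; rewrite cos2.
    rewrite (sin_eq_0_1 (IZR k * PI)) by now exists k. unfold Rsqr; ring. }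
  rewrite Rmult_0_r, Rminus_0_r, Rabs_mult, H; ring.
Qed.

Lemma Rabs_sin_le x : Rabs (sin x) <= Rabs x.
Proof.
  assert (P : forall y, 0 <= y -> sin y <= y).
  { intros y [Hy| <-]; [left; now apply sin_lt_x|rewrite sin_0; lra]. }
  assert (Q : forall y, 0 <= y -> - y <= sin y).
  { intros y Hy. destruct (Rle_lt_dec y 3) as [H3|H3].
    - assert (0 <= sin y); [|lra]. apply sin_ge_0; [lra|].
      pose proof PI2_3_2; unfold PI2 in *; lra.
    - pose proof (SIN_bound y); lra. }
  destruct (Rle_lt_dec 0 x) as [H|H].
  - rewrite (Rabs_pos_eq x H); apply Rabs_le; split; auto.
  - rewrite (Rabs_left x H).
    rewrite <- Rabs_Ropp, <- sin_neg. apply Rabs_le; split; [apply Q|apply P]; lra.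
Qed.

(** On [0, 2], sin u >= u - u^3 / 6 >= u / 3, and [PI] > 3; oddness gives the negative case. *)
Lemma Rabs_sin_PI_ge x : Rabs x <= 1 / 2 -> Rabs x <= Rabs (sin (PI * x)).
Proof.
  assert (P : forall y, 0 <= y <= 1 / 2 -> y <= sin (PI * y)).
  { intros y Hy; pose proof PI2_3_2; pose proof PI_4; unfold PI2 in *.
    destruct (sin_bound (PI * y) 0) as [H1 _]; [nra|nra|].
    assert (P1 : 0 <= PI * y <= 2) by nra.
    set (u := PI * y) in *.
    unfold sin_approx, sin_term in H1; simpl in H1.
    assert (u / 3 <= sin u) by nra.
    assert (3 * y <= u) by (unfold u; nra); lra. }
  intros Hx; destruct (Rle_lt_dec 0 x) as [H|H].
  - rewrite (Rabs_pos_eq x H) in *. eapply Rle_trans; [apply P; lra|apply Rle_abs].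
  - rewrite (Rabs_left x H) in *. rewrite <- (Rabs_Ropp (sin _)), <- sin_neg.
    replace (- (PI * x)) with (PI * - x) by ring.
    eapply Rle_trans; [apply P; lra|apply Rle_abs].
Qed.

(** Times [sin (A / 2)], each term is half a difference of two sines, so the sum telescopes. The
    factor stays on the left so that [A] may be a multiple of 2 [PI]. *)
Lemma cos_sum a A n :
  sin (A / 2) * lsum (fun k => cos (a + IZR k * A)) (zrange n) =
  sin (INR n * A / 2) * cos (a + (INR n - 1) * A / 2).
Proof.
  induction n as [|n IH].
  - unfold lsum; simpl. replace (0 * A / 2) with 0 by lra. rewrite sin_0; ring.
  - rewrite lsum_zrange_S, Rmult_plus_distr_l, IH, S_INR, <- INR_IZR_INZ.
    set (N := INR n).
    replace (a + (N - 1) * A / 2) with ((a + N * A / 2) - A / 2) by field.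
    replace (a + N * A) with ((a + N * A / 2) + N * A / 2) by field.
    replace ((N + 1) * A / 2) with (N * A / 2 + A / 2) by field.
    replace (a + (N + 1 - 1) * A / 2) with (a + N * A / 2) by field.
    set (u := N * A / 2); set (w := A / 2).
    rewrite cos_minus, (cos_plus _ u), sin_plus, !cos_plus, !sin_plus.
    ring.
Qed.

(** Real form of a geometric sum: |[C]| is the modulus of the sum of exp(i k A) over k < n, and [b]
    records its argument. Letting [a] vary takes the place of complex numbers. *)
Definition amplitude (n : nat) (A C : R) : Prop :=
  exists b, forall a,
    lsum (fun k => cos (a + IZR k * A)) (zrange n) = C * cos (a + b).

(* [h] stands for a lower bound on [|sin (PI x) / x|] at [x = n th]; this form covers [th = 0]. *)
Lemma amplitude_ge (n : nat) (th h : R) :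
  Rabs th < 1 -> 0 <= h <= 1 ->
  h * Rabs (INR n * th) <= Rabs (sin (PI * (INR n * th))) ->
  exists C, amplitude n (2 * PI * th) C /\ h * INR n / 4 <= Rabs C.
Proof.
  intros Hth Hh Hs; pose proof (pos_INR n) as Hn; pose proof PI_4; pose proof PI_RGT_0.
  destruct (Req_dec th 0) as [->|Hth0].
  - exists (INR n); split; [|rewrite Rabs_pos_eq by lra; nra].
    exists 0; intros a; clear.
    induction n as [|n IH]; [unfold lsum; simpl; lra|].
    rewrite lsum_zrange_S, IH, S_INR.
    replace (a + IZR (Z.of_nat n) * (2 * PI * 0)) with (a + 0) by ring; ring.
  - assert (S0 : sin (PI * th) <> 0).
    { intros E; apply sin_eq_0_0 in E as (k & Ek).
      assert (th = IZR k) as -> by nra.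
      rewrite <- abs_IZR in Hth; apply lt_IZR in Hth.
      apply Hth0; f_equal; lia. }
    exists (sin (PI * (INR n * th)) / sin (PI * th)); split.
    + exists ((INR n - 1) * (2 * PI * th) / 2); intros a.
      pose proof (cos_sum a (2 * PI * th) n) as E.
      replace (2 * PI * th / 2) with (PI * th) in E by field.
      replace (INR n * (2 * PI * th) / 2) with (PI * (INR n * th)) in E by field.
      apply (Rmult_eq_reg_l (sin (PI * th))); [rewrite E; field|]; exact S0.
    + unfold Rdiv at 2; rewrite Rabs_mult, Rabs_inv.
      apply (Rmult_le_reg_r (Rabs (sin (PI * th)))); [now apply Rabs_pos_lt|].
      rewrite Rmult_assoc, Rinv_l, Rmult_1_r by now apply Rabs_no_R0.
      eapply Rle_trans; [|exact Hs].
      pose proof (Rabs_sin_le (PI * th)) as HL.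
      rewrite Rabs_mult in *; rewrite (Rabs_pos_eq PI) in HL by lra.
      rewrite (Rabs_pos_eq (INR n)) by lra.
      pose proof (Rabs_pos th).
      (* The bound [PI] <= 4 is the source of the 4 in the conclusion. *)
      assert (Rabs (sin (PI * th)) <= 4 * Rabs th) by nra.
      assert (0 <= h * INR n) by nra. nra.
Qed.

(* Orthogonality of a nontrivial character of Z/N to the constants. *)
Lemma amplitude_full (N : nat) (m : Z) :
  (0 < Z.abs m < Z.of_nat N)%Z -> amplitude N (2 * PI * (IZR m / INR N)) 0.
Proof.
  intros Hm.
  assert (HN : 0 < INR N) by (apply lt_0_INR; lia).
  exists 0; intros a.
  pose proof (cos_sum a (2 * PI * (IZR m / INR N)) N) as E.
  replace (INR N * (2 * PI * (IZR m / INR N)) / 2) with (IZR m * PI) in E by (field; lra).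
  rewrite (sin_eq_0_1 (IZR m * PI)) in E by now exists m.
  rewrite Rmult_0_l in E; apply Rmult_integral in E as [E|E]; [|rewrite Rmult_0_l; exact E].
  exfalso; apply sin_eq_0_0 in E as (k & E).
  pose proof PI_RGT_0.
  assert (E2 : IZR m = IZR (k * Z.of_nat N)).
  { rewrite mult_IZR, <- INR_IZR_INZ.
    apply (Rmult_eq_reg_l PI); [|lra].
    replace (PI * IZR m) with (INR N * (2 * PI * (IZR m / INR N) / 2)) by (field; lra).
    rewrite E; ring. }
  apply eq_IZR in E2; subst m; rewrite Z.abs_mul, (Z.abs_eq (Z.of_nat N)) in Hm by lia.
  destruct (Z.eq_dec k 0) as [->|Hk]; [simpl in Hm; lia|].
  assert (1 <= Z.abs k)%Z by lia; nia.
Qed.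

(** A character of the grid factors over the coordinates, so amplitudes multiply and phases add. *)
Lemma grid_sum (n : nat) (A1 A2 A3 C1 C2 C3 : R) :
  amplitude n A1 C1 -> amplitude n A2 C2 -> amplitude n A3 C3 ->
  exists b, forall a,
    lsum (fun x : Z * Z * Z =>
            cos (a + IZR (fst (fst x)) * A1 + IZR (snd (fst x)) * A2 + IZR (snd x) * A3))
         (grid n) = C1 * C2 * C3 * cos (a + b).
Proof.
  intros [b1 H1] [b2 H2] [b3 H3]; exists (b1 + b2 + b3); intros a.
  unfold grid; rewrite lsum_list_prod; simpl.
  rewrite (lsum_ext _ (fun x : Z * Z =>
     C3 * cos (a + b3 + IZR (fst x) * A1 + IZR (snd x) * A2))).
  2:{ intros x _; rewrite H3; do 2 f_equal; ring. }
  rewrite lsum_scal, lsum_list_prod; simpl.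
  rewrite (lsum_ext _ (fun x : Z => C2 * cos (a + b3 + b2 + IZR x * A1))).
  2:{ intros x _; rewrite H2; do 2 f_equal; ring. }
  rewrite lsum_scal, H1.
  replace (a + (b1 + b2 + b3)) with (a + b3 + b2 + b1) by ring; ring.
Qed.

(** * Disjoint cubes in the torus *)

Lemma mod_sub_divides a b N : (a mod N = b mod N -> exists d, a - b = N * d)%Z.
Proof.
  intros E; exists (a / N - b / N)%Z.
  pose proof (Z_div_mod_eq_full a N); pose proof (Z_div_mod_eq_full b N); lia.
Qed.

(** The copy of the grid point [(x, y, z)] in the [k]-th cube, whose corner is k V in the torus
    (Z/N)^3. *)
Definition translate (N : nat) (V : Z * Z * Z) (u : Z * (Z * Z * Z)) : Z * Z * Z :=
  let '(k, (x, y, z)) := u in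
  let '(V1, V2, V3) := V in
  (((k * V1 + x) mod Z.of_nat N)%Z, ((k * V2 + y) mod Z.of_nat N)%Z,
   ((k * V3 + z) mod Z.of_nat N)%Z).

(** If the cubes [k] and [k'] share a point, then (k - k') V is, modulo [N], a difference of two
    vectors with entries in [0, L). So [q] is |k - k'|. *)
Lemma translate_collision (N n L : nat) (V1 V2 V3 : Z) u u' :
  (L <= N)%nat ->
  In u (list_prod (zrange n) (grid L)) -> In u' (list_prod (zrange n) (grid L)) ->
  translate N (V1, V2, V3) u = translate N (V1, V2, V3) u' -> u <> u' ->
  exists q p1 p2 p3 : Z, (1 <= q < Z.of_nat n)%Z /\
    (Z.abs (q * V1 - Z.of_nat N * p1) < Z.of_nat L)%Z /\
    (Z.abs (q * V2 - Z.of_nat N * p2) < Z.of_nat L)%Z /\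
    (Z.abs (q * V3 - Z.of_nat N * p3) < Z.of_nat L)%Z.
Proof.
  intros HL; destruct u as [k [[x y] z]], u' as [k' [[x' y'] z']].
  rewrite !in_prod_iff, !in_grid, !in_zrange; simpl.
  intros (Hk & Hx & Hy & Hz) (Hk' & Hx' & Hy' & Hz') E Hne.
  inversion E as [[E1 E2 E3]]; clear E.
  apply mod_sub_divides in E1 as [d1 E1], E2 as [d2 E2], E3 as [d3 E3].
  destruct (Z.lt_trichotomy k k') as [Hlt|[->|Hlt]].
  - exists (k' - k)%Z, (- d1)%Z, (- d2)%Z, (- d3)%Z; lia.
  (* Within a single cube, reduction modulo [N] is injective because [L <= N]. *)
  - exfalso; apply Hne.
    assert (d1 = 0%Z) by nia; assert (d2 = 0%Z) by nia; assert (d3 = 0%Z) by nia.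
    subst; repeat f_equal; lia.
  - exists (k - k')%Z, d1, d2, d3; lia.
Qed.

(** Were the cubes disjoint, their n L^3 points would lie in the grid without repetition. A
    character wave [w] of frequency [(m1, m2, m3)] sums to 0 over the grid and, with the right
    phase, to at most - h n L^3 / 256 over the cubes. Comparing the sums of 1 - w gives n L^3 (1 + h
    / 256) <= N^3. *)
Lemma torus_packing (N n L : nat) (V1 V2 V3 m0 m1 m2 m3 : Z) (h : R) :
  let th := IZR (m0 * Z.of_nat N + m1 * V1 + m2 * V2 + m3 * V3) / INR N in
  (1 <= L)%nat ->
  (m1 <> 0 \/ m2 <> 0 \/ m3 <> 0)%Z ->
  (2 * Z.abs m1 * Z.of_nat L <= Z.of_nat N)%Z ->
  (2 * Z.abs m2 * Z.of_nat L <= Z.of_nat N)%Z ->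
  (2 * Z.abs m3 * Z.of_nat L <= Z.of_nat N)%Z ->
  Rabs th < 1 -> 0 <= h <= 1 ->
  h * Rabs (INR n * th) <= Rabs (sin (PI * (INR n * th))) ->
  INR N ^ 3 < INR n * INR L ^ 3 * (1 + h / 256) ->
  exists q p1 p2 p3 : Z, (1 <= q < Z.of_nat n)%Z /\
    (Z.abs (q * V1 - Z.of_nat N * p1) < Z.of_nat L)%Z /\
    (Z.abs (q * V2 - Z.of_nat N * p2) < Z.of_nat L)%Z /\
    (Z.abs (q * V3 - Z.of_nat N * p3) < Z.of_nat L)%Z.
Proof.
  intros th HL1 Hm HM1 HM2 HM3 Hth Hh Hs Hvol.
  assert (HLN : (2 * L <= N)%nat) by nia.
  assert (HN : 0 < INR N) by (apply lt_0_INR; lia).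
  assert (HL : 0 < INR L) by (apply lt_0_INR; lia).
  pose proof (pos_INR n) as Hn.
  set (D := list_prod (zrange n) (grid L)).
  destruct (classic (NoDup (map (translate N (V1, V2, V3)) D))) as [HD|HD].
  (* Overlapping cubes yield [q] directly, so only the disjoint case remains. *)
  2:{ apply NNPP; intros Hno; apply HD; apply NoDup_map_inj.
      - apply NoDup_list_prod; [apply NoDup_zrange|apply NoDup_grid].
      - intros u u' Hu Hu' E; apply NNPP; intros Hne; apply Hno.
        apply (translate_collision N n L V1 V2 V3 u u'); auto; lia. }
  exfalso.
  set (A := fun m : Z => 2 * PI * (IZR m / INR N)).
  assert (Hamp : forall m, (2 * Z.abs m * Z.of_nat L <= Z.of_nat N)%Z ->
            exists C, amplitude L (A m) C /\ INR L / 4 <= Rabs C).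
  { intros m HM.
    destruct (amplitude_ge L (IZR m / INR N) 1) as (C & HC & HC'); [| lra | | ].
    - unfold Rdiv; rewrite Rabs_mult, Rabs_inv, (Rabs_pos_eq (INR N)) by lra.
      apply (Rmult_lt_reg_r (INR N)); [lra|].
      rewrite Rmult_assoc, Rinv_l, Rmult_1_r, Rmult_1_l by lra.
      rewrite <- abs_IZR, INR_IZR_INZ; apply IZR_lt; nia.
    - rewrite Rmult_1_l; apply Rabs_sin_PI_ge.
      unfold Rdiv; rewrite !Rabs_mult, Rabs_inv, (Rabs_pos_eq (INR N)), (Rabs_pos_eq (INR L)) by lra.
      apply (Rmult_le_reg_r (2 * INR N)); [lra|].
      replace (INR L * (Rabs (IZR m) * / INR N) * (2 * INR N))
        with (2 * Rabs (IZR m) * INR L) by (field; lra).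
      replace (1 * / 2 * (2 * INR N)) with (INR N) by field.
      rewrite <- abs_IZR, !INR_IZR_INZ, <- !mult_IZR; now apply IZR_le.
    - exists C; split; [exact HC|]; lra. }
  destruct (Hamp m1 HM1) as (C1 & HC1 & HC1').
  destruct (Hamp m2 HM2) as (C2 & HC2 & HC2').
  destruct (Hamp m3 HM3) as (C3 & HC3 & HC3').
  destruct (amplitude_ge n th h Hth Hh Hs) as (C0 & [b0 HC0] & HC0').
  destruct (grid_sum L _ _ _ _ _ _ HC1 HC2 HC3) as [b Hb].
  set (K := C1 * C2 * C3 * C0).
  (* Each of the four amplitudes loses a factor 4, and 256 = 4^4. *)
  assert (HK : h * INR n * INR L ^ 3 / 256 <= Rabs K).
  { unfold K; rewrite !Rabs_mult.
    replace (h * INR n * INR L ^ 3 / 256)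
      with (INR L / 4 * (INR L / 4) * (INR L / 4) * (h * INR n / 4)) by field.
    assert (0 <= h * INR n) by (apply Rmult_le_pos; lra).
    repeat (apply Rmult_le_compat; [repeat apply Rmult_le_pos; lra|lra| |lra]); lra. }
  (* The phase is chosen to make the sum over the cubes as negative as possible. *)
  assert (Hphase : exists a, K * cos (a + b + b0) = - Rabs K).
  { destruct (Rle_lt_dec 0 K).
    - exists (PI - b - b0). replace (PI - b - b0 + b + b0) with PI by ring.
      rewrite cos_PI, Rabs_pos_eq by lra; ring.
    - exists (- b - b0). replace (- b - b0 + b + b0) with 0 by ring.
      rewrite cos_0, Rabs_left by lra; ring. }
  destruct Hphase as [a Ha].
  set (w := fun x : Z * Z * Z =>
    cos (a + IZR (fst (fst x)) * A m1 + IZR (snd (fst x)) * A m2 + IZR (snd x) * A m3)).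
  assert (Hfull : lsum w (grid N) = 0).
  (* One vanishing factor suffices, so for [m = 0] any amplitude will do. *)
  { assert (Hany : forall m, (2 * Z.abs m * Z.of_nat L <= Z.of_nat N)%Z ->
              exists C, amplitude N (A m) C /\ (m <> 0%Z -> C = 0)).
    { intros m HM; destruct (Z.eq_dec m 0) as [->|Hm0].
      - destruct (amplitude_ge N (IZR 0 / INR N) 0) as (C & HC & _); [| lra | |].
        + unfold Rdiv; rewrite Rmult_0_l, Rabs_R0; lra.
        + rewrite Rmult_0_l; apply Rabs_pos.
        + exists C; split; [exact HC|tauto].
      - exists 0; split; [|reflexivity]. apply amplitude_full; nia. }
    destruct (Hany m1 HM1) as (B1 & HB1 & HB1').
    destruct (Hany m2 HM2) as (B2 & HB2 & HB2').
    destruct (Hany m3 HM3) as (B3 & HB3 & HB3').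
    destruct (grid_sum N _ _ _ _ _ _ HB1 HB2 HB3) as [c Hc].
    unfold w; rewrite Hc.
    destruct Hm as [Hm|[Hm|Hm]]; [rewrite HB1'|rewrite HB2'|rewrite HB3']; auto; ring. }
  assert (Himg : lsum w (map (translate N (V1, V2, V3)) D) = - Rabs K).
  { rewrite lsum_map.
    rewrite (lsum_ext _ (fun u : Z * (Z * Z * Z) =>
      cos (a + IZR (fst u) * (2 * PI * th) + IZR (fst (fst (snd u))) * A m1
           + IZR (snd (fst (snd u))) * A m2 + IZR (snd (snd u)) * A m3))).
    2:{ intros [k [[x y] z]] _; unfold w, translate; simpl.
        pose proof (Z_div_mod_eq_full (k * V1 + x) (Z.of_nat N)) as E1.
        pose proof (Z_div_mod_eq_full (k * V2 + y) (Z.of_nat N)) as E2.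
        pose proof (Z_div_mod_eq_full (k * V3 + z) (Z.of_nat N)) as E3.
        set (d1 := ((k * V1 + x) / Z.of_nat N)%Z) in *.
        set (d2 := ((k * V2 + y) / Z.of_nat N)%Z) in *.
        set (d3 := ((k * V3 + z) / Z.of_nat N)%Z) in *.
        apply (f_equal IZR) in E1, E2, E3.
        rewrite !plus_IZR, !mult_IZR, <- INR_IZR_INZ in E1, E2, E3.
        (* Reduction modulo [N] and the term [m0] change the angle by whole turns only. *)
        rewrite <- (cos_period_Z _ (k * m0 + m1 * d1 + m2 * d2 + m3 * d3)).
        f_equal; unfold A, th; rewrite !plus_IZR, !mult_IZR, <- INR_IZR_INZ.
        set (r1 := IZR ((k * V1 + x) mod Z.of_nat N)) in *.
        set (r2 := IZR ((k * V2 + y) mod Z.of_nat N)) in *.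
        set (r3 := IZR ((k * V3 + z) mod Z.of_nat N)) in *.
        replace (IZR x) with (INR N * IZR d1 + r1 - IZR k * IZR V1) by lra.
        replace (IZR y) with (INR N * IZR d2 + r2 - IZR k * IZR V2) by lra.
        replace (IZR z) with (INR N * IZR d3 + r3 - IZR k * IZR V3) by lra.
        field; lra. }
    unfold D; rewrite lsum_list_prod; simpl.
    rewrite (lsum_ext _ (fun k => C1 * C2 * C3 * cos (a + b + IZR k * (2 * PI * th)))).
    2:{ intros k _.
        replace (a + b + IZR k * (2 * PI * th)) with (a + IZR k * (2 * PI * th) + b) by ring.
        rewrite <- Hb; reflexivity. }
    rewrite lsum_scal, HC0, <- Ha; unfold K; ring. }
  (* [1 - w] is nonnegative, so its sum over the disjoint cubes is at most its sum over the grid. *)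
  assert (Hincl : lsum (fun x => 1 - w x) (map (translate N (V1, V2, V3)) D)
                  <= lsum (fun x => 1 - w x) (grid N)).
  { apply lsum_incl; [exact HD| |].
    - intros x Hx; apply in_map_iff in Hx as ([k [[x1 x2] x3]] & <- & _).
      apply in_grid; repeat split; apply Z.mod_pos_bound; lia.
    - intros x; unfold w; pose proof (COS_bound
        (a + IZR (fst (fst x)) * A m1 + IZR (snd (fst x)) * A m2 + IZR (snd x) * A m3)); lra. }
  rewrite !lsum_one_minus, Hfull, Himg, length_map in Hincl.
  unfold D in Hincl; rewrite length_prod, !length_grid, length_zrange, !mult_INR in Hincl.
  simpl in Hvol, HK. lra.
Qed.

(** * Passage from the grid to real points *)

Lemma IZR_Rabs_lt a b : (Z.abs a < b)%Z -> Rabs (IZR a) < IZR b.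
Proof. intros H; rewrite <- abs_IZR; now apply IZR_lt. Qed.

(** Replacing N a by its floor moves q N a by at most [q], hence by at most [n]; the margin between
    [L] and d N absorbs this. *)
Lemma Rabs_sub_lt_of_floor (a d : R) (N L n : nat) (q p : Z) :
  0 < INR N -> (0 <= q <= Z.of_nat n)%Z -> INR L + INR n <= d * INR N ->
  (Z.abs (q * Zfloor (INR N * a) - Z.of_nat N * p) < Z.of_nat L)%Z ->
  Rabs (IZR q * a - IZR p) < d.
Proof.
  intros HN [Hq0 Hqn] HL H.
  apply IZR_Rabs_lt in H; rewrite minus_IZR, !mult_IZR, <- !INR_IZR_INZ in H.
  apply IZR_le in Hq0, Hqn; rewrite <- INR_IZR_INZ in Hqn.
  pose proof (Zfloor_bound (INR N * a)) as Hf.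
  set (V := IZR (Zfloor (INR N * a))) in *.
  apply Rabs_def2 in H as [H1 H2].
  apply Rabs_def1; apply (Rmult_lt_reg_l (INR N)); nra.
Qed.

Lemma exists_nat_gt4 (a b c d : R) :
  exists N : nat, a < INR N /\ b < INR N /\ c < INR N /\ d < INR N.
Proof.
  destruct (INR_unbounded (Rmax (Rmax a b) (Rmax c d))) as [N HN]; exists N.
  pose proof (Rmax_l a b); pose proof (Rmax_r a b); pose proof (Rmax_l c d);
  pose proof (Rmax_r c d); pose proof (Rmax_l (Rmax a b) (Rmax c d));
  pose proof (Rmax_r (Rmax a b) (Rmax c d)); lra.
Qed.

(** This is [torus_packing] for large [N], with V the floors of the N a_i and [L] about d N. The
    form at V/N differs slightly from [th], which is why the bound on the sine is asked on a
    neighbourhood of radius [r]. *)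
Lemma simultaneous_approx (a1 a2 a3 : R) (n : nat) (m0 m1 m2 m3 : Z) (d h r : R) :
  let th := IZR m0 + IZR m1 * a1 + IZR m2 * a2 + IZR m3 * a3 in
  0 < d ->
  (m1 <> 0 \/ m2 <> 0 \/ m3 <> 0)%Z ->
  2 * Rabs (IZR m1) * d <= 1 -> 2 * Rabs (IZR m2) * d <= 1 -> 2 * Rabs (IZR m3) * d <= 1 ->
  Rabs th < 1 -> 0 <= h <= 1 -> 0 < r ->
  (forall x, Rabs (x - INR n * th) <= r -> h * Rabs x <= Rabs (sin (PI * x))) ->
  1 < INR n * d ^ 3 * (1 + h / 256) ->
  exists q p1 p2 p3 : Z, (1 <= q < Z.of_nat n)%Z /\
    Rabs (IZR q * a1 - IZR p1) < d /\
    Rabs (IZR q * a2 - IZR p2) < d /\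
    Rabs (IZR q * a3 - IZR p3) < d.
Proof.
  intros th Hd Hm HM1 HM2 HM3 Hth Hh Hr Hx Hvol.
  pose proof (pos_INR n) as Hn.
  set (S := Rabs (IZR m1) + Rabs (IZR m2) + Rabs (IZR m3)).
  set (G := INR n * (1 + h / 256)).
  assert (HG : 0 < G * d ^ 3 - 1) by (unfold G; lra).
  assert (HG0 : 0 <= G) by (apply Rmult_le_pos; lra).
  pose proof (Rabs_pos (IZR m1)); pose proof (Rabs_pos (IZR m2)); pose proof (Rabs_pos (IZR m3)).
  (* In turn, these bounds on [N] keep n th' within [r] of n th, keep |th'| < 1, make [L] positive,
     and save the volume inequality when d N is shrunk to [L]. *)
  destruct (exists_nat_gt4 (INR n * S / r) (S / (1 - Rabs th)) ((INR n + 2) / d)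
              (3 * G * d ^ 2 * (INR n + 1) / (G * d ^ 3 - 1))) as (N & N1 & N2 & N3 & N4).
  apply (Rmult_lt_compat_r r) in N1; [|lra].
  apply (Rmult_lt_compat_r (1 - Rabs th)) in N2; [|lra].
  apply (Rmult_lt_compat_r d) in N3; [|lra].
  apply (Rmult_lt_compat_r (G * d ^ 3 - 1)) in N4; [|lra].
  unfold Rdiv in N1, N2, N3, N4.
  rewrite Rmult_assoc, Rinv_l, Rmult_1_r in N1, N2, N3, N4 by lra.
  assert (HN : 0 < INR N) by nra.
  set (L := Z.to_nat (Zfloor (d * INR N - INR n))).
  pose proof (Zfloor_bound (d * INR N - INR n)) as HL.
  assert (HL1 : (1 <= Zfloor (d * INR N - INR n))%Z) by (apply Zfloor_lub; lra).
  assert (EL : INR L = IZR (Zfloor (d * INR N - INR n))).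
  { unfold L; rewrite INR_IZR_INZ, Z2Nat.id by lia; reflexivity. }
  rewrite <- EL in HL.
  assert (HML : forall m, 2 * Rabs (IZR m) * d <= 1 ->
                  (2 * Z.abs m * Z.of_nat L <= Z.of_nat N)%Z).
  { intros m Hm'; apply le_IZR; rewrite !mult_IZR, abs_IZR, <- !INR_IZR_INZ.
    pose proof (Rabs_pos (IZR m)).
    apply Rle_trans with (2 * Rabs (IZR m) * (d * INR N)); [|nra].
    apply Rmult_le_compat_l; lra. }
  set (V1 := Zfloor (INR N * a1)); set (V2 := Zfloor (INR N * a2));
  set (V3 := Zfloor (INR N * a3)).
  pose proof (Zfloor_bound (INR N * a1)) as F1; fold V1 in F1.
  pose proof (Zfloor_bound (INR N * a2)) as F2; fold V2 in F2.
  pose proof (Zfloor_bound (INR N * a3)) as F3; fold V3 in F3.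
  set (th' := IZR (m0 * Z.of_nat N + m1 * V1 + m2 * V2 + m3 * V3) / INR N).
  assert (Hth' : INR N * Rabs (th' - th) <= S).
  { rewrite <- (Rabs_pos_eq (INR N)) at 1 by lra; rewrite <- Rabs_mult.
    replace (INR N * (th' - th)) with
      (IZR m1 * (IZR V1 - INR N * a1) + IZR m2 * (IZR V2 - INR N * a2)
       + IZR m3 * (IZR V3 - INR N * a3)).
    2:{ unfold th', th; rewrite !plus_IZR, !mult_IZR, <- INR_IZR_INZ; field; lra. }
    assert (P : forall m x, -1 <= x <= 0 -> Rabs (IZR m * x) <= Rabs (IZR m)).
    { intros m x Hx'; rewrite Rabs_mult, (Rabs_left1 x) by lra.
      pose proof (Rabs_pos (IZR m)); nra. }
    eapply Rle_trans; [apply Rabs_triang|]; apply Rplus_le_compat; [|apply P; lra].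
    eapply Rle_trans; [apply Rabs_triang|]; apply Rplus_le_compat; apply P; lra. }
  destruct (torus_packing N n L V1 V2 V3 m0 m1 m2 m3 h) as (q & p1 & p2 & p3 & Hq & Q1 & Q2 & Q3);
    fold th'; auto.
  - lia.
  - assert (Rabs (th' - th) < 1 - Rabs th) by nra.
    replace th' with ((th' - th) + th) by ring.
    pose proof (Rabs_triang (th' - th) th); lra.
  - apply Hx. rewrite <- Rmult_minus_distr_l, Rabs_mult, (Rabs_pos_eq (INR n)) by lra.
    pose proof (Rabs_pos (th' - th)).
    apply (Rmult_le_reg_l (INR N)); [lra|]. nra.
  - assert (HL3 : d * INR N - (INR n + 1) <= INR L) by lra.
    assert (HL4 : (d * INR N - (INR n + 1)) ^ 3 <= INR L ^ 3) by (apply pow_incr; lra).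
    (* The side shrinks by at most n + 1: [n] as margin and 1 from the floor. *)
    assert (HL5 : (d * INR N) ^ 3 - 3 * (d * INR N) ^ 2 * (INR n + 1)
                  <= (d * INR N - (INR n + 1)) ^ 3).
    { set (x := d * INR N) in *; set (y := INR n + 1) in *.
      assert (0 <= y <= x) by (unfold x, y; lra).
      assert (0 <= 3 * x * y ^ 2 - y ^ 3); [|simpl in *; lra].
      replace (3 * x * y ^ 2 - y ^ 3) with (y ^ 2 * (3 * x - y)) by ring.
      apply Rmult_le_pos; [apply pow2_ge_0|lra]. }
    replace (INR n * INR L ^ 3 * (1 + h / 256)) with (G * INR L ^ 3) by (unfold G; ring).
    apply Rlt_le_trans with
      (G * ((d * INR N) ^ 3 - 3 * (d * INR N) ^ 2 * (INR n + 1)));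
      [|apply Rmult_le_compat_l; lra].
    assert (0 < INR N ^ 2) by (apply pow_lt; lra).
    assert (0 < INR N ^ 2 * (INR N * (G * d ^ 3 - 1) - 3 * G * d ^ 2 * (INR n + 1)));
      [apply Rmult_lt_0_compat; lra|simpl in *; lra].
  - exists q, p1, p2, p3; split; [exact Hq|].
    assert (HLd : INR L + INR n <= d * INR N) by lra.
    repeat split; eapply Rabs_sub_lt_of_floor; eauto; lia.
Qed.

(** * Dirichlet improvability along the line *)

(** Infinite descent: [p] divides [p * e] exactly once, so it divides both [a] and [b] and can be
    cancelled. The factor [e] lets 6 = 2 * 3 be treated along with 2 and 3. *)
Lemma square_eq_prime_mult (p e : Z) :
  prime p -> ~ (p | e)%Z -> forall a b : Z, (a * a = p * e * (b * b))%Z -> b = 0%Z.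
Proof.
  intros Hp He.
  pose proof (prime_ge_2 p Hp) as Hp2.
  assert (P : forall n : nat, forall a b : Z, (Z.abs b <= Z.of_nat n)%Z ->
                (a * a = p * e * (b * b))%Z -> b = 0%Z).
  { induction n as [|n IH]; intros a b Hb E; [lia|].
    assert (Da : (p | a)%Z).
    { destruct (prime_mult p Hp a a); auto. exists (e * (b * b))%Z; lia. }
    destruct Da as [a' ->].
    assert (E' : (p * (a' * a') = e * (b * b))%Z).
    { apply (Z.mul_reg_l _ _ p); [lia|]; lia. }
    assert (Db : (p | b)%Z).
    { destruct (prime_mult p Hp e (b * b)) as [D|D]; [exists (a' * a')%Z; lia|tauto|].
      destruct (prime_mult p Hp b b D); auto. }
    destruct Db as [b' ->].
    assert (E'' : (a' * a' = p * e * (b' * b'))%Z).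
    { apply (Z.mul_reg_l _ _ p); [lia|]; lia. }
    destruct (Z.eq_dec b' 0) as [->|Hb']; [reflexivity|].
    rewrite (IH a' b'); [reflexivity| |exact E''].
    rewrite Z.abs_mul, (Z.abs_eq p) in Hb by lia; nia. }
  intros a b; apply (P (Z.to_nat (Z.abs b))); lia.
Qed.

(** For x = j + u and sqrt 2 x = k + w, the nonzero integer 2 j^2 - k^2 factors as (sqrt 2 j -
    k)(sqrt 2 j + k). The first factor is w - sqrt 2 u, below 3 eta in modulus, and the second is at
    most 3 B + 3; [eta] makes the product of these bounds 1. *)
Lemma sqrt2_not_near_integers (x B : R) :
  Rabs x <= B ->
  let eta := 1 / (9 * B + 9) in
  ~ (exists j : Z, j <> 0%Z /\ Rabs (x - IZR j) < eta) \/
  ~ (exists j : Z, j <> 0%Z /\ Rabs (sqrt 2 * x - IZR j) < eta).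
Proof.
  intros Hx eta; apply not_and_or; intros [(j & Hj & H1) (k & _ & H2)].
  pose proof (Rabs_pos x).
  assert (S2 : sqrt 2 * sqrt 2 = 2) by (apply sqrt_sqrt; lra).
  assert (S0 : 1.4 < sqrt 2 < 1.5) by (pose proof (sqrt_pos 2); split; nra).
  assert (Heta : eta * (9 * B + 9) = 1) by (unfold eta; field; lra).
  assert (Heta0 : 0 < eta <= 1 / 9) by (split; nra).
  set (u := x - IZR j) in *; set (w := sqrt 2 * x - IZR k) in *.
  assert (E : 2 * (IZR j * IZR j) - IZR k * IZR k
              = (w - sqrt 2 * u) * (2 * (sqrt 2 * x) - sqrt 2 * u - w)).
  { unfold u, w; replace 2 with (sqrt 2 * sqrt 2) at 1; ring. }
  assert (N : (2 * (j * j) - k * k <> 0)%Z).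
  { intros N; apply Hj. apply (square_eq_prime_mult 2 1 prime_2) with (a := k); [|lia].
    intros [z Hz]; lia. }
  assert (N' : 1 <= Rabs (2 * (IZR j * IZR j) - IZR k * IZR k)).
  { rewrite <- !mult_IZR, <- minus_IZR, <- abs_IZR; apply IZR_le; lia. }
  rewrite E, Rabs_mult in N'.
  assert (Rabs (w - sqrt 2 * u) < 3 * eta).
  { unfold Rminus; eapply Rle_lt_trans; [apply Rabs_triang|].
    rewrite Rabs_Ropp, Rabs_mult, (Rabs_pos_eq (sqrt 2)) by lra.
    pose proof (Rabs_pos u); nra. }
  assert (Rabs (2 * (sqrt 2 * x) - sqrt 2 * u - w) <= 3 * B + 3).
  { unfold Rminus; eapply Rle_trans; [apply Rabs_triang|].
    eapply Rle_trans; [apply Rplus_le_compat_r, Rabs_triang|].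
    rewrite !Rabs_Ropp, !Rabs_mult, (Rabs_pos_eq (sqrt 2)), (Rabs_pos_eq 2) by lra.
    pose proof (Rabs_pos u); nra. }
  pose proof (Rabs_pos (w - sqrt 2 * u)). nra.
Qed.

(** Let [j] be an integer nearest to [y]. If j = 0, then |sin (PI y)| >= |y|; otherwise |y - j| >=
    eta / 2 while |y| <= B + 1. *)
Lemma Rabs_sin_PI_ge_far (x y B eta : R) :
  0 < eta <= 1 / 2 -> Rabs x <= B ->
  ~ (exists j : Z, j <> 0%Z /\ Rabs (x - IZR j) < eta) ->
  Rabs (y - x) <= eta / 2 ->
  eta / (2 * (B + 1)) * Rabs y <= Rabs (sin (PI * y)).
Proof.
  intros He Hx Hfar Hy.
  pose proof (Rabs_pos x).
  set (h := eta / (2 * (B + 1))).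
  assert (Hh : h * (2 * (B + 1)) = eta) by (unfold h; field; lra).
  assert (Hh0 : 0 < h <= 1) by (split; nra).
  assert (Hyb : Rabs y <= B + 1).
  { replace y with ((y - x) + x) by ring.
    pose proof (Rabs_triang (y - x) x); lra. }
  pose proof (Zfloor_bound (y + 1 / 2)) as Hj.
  set (j := Zfloor (y + 1 / 2)) in *.
  assert (Hyj : Rabs (y - IZR j) <= 1 / 2) by (apply Rabs_le; lra).
  apply Rabs_sin_PI_ge in Hyj.
  replace (PI * (y - IZR j)) with (PI * y - IZR j * PI) in Hyj by ring.
  rewrite Rabs_sin_shift in Hyj.
  pose proof (Rabs_pos y).
  destruct (Z.eq_dec j 0) as [E|E].
  - rewrite E, Rminus_0_r in Hyj; nra.
  - assert (eta <= Rabs (x - IZR j)).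
    { apply Rnot_lt_le; intros Hlt; apply Hfar; now exists j. }
    assert (Rabs (x - IZR j) <= Rabs (y - IZR j) + Rabs (y - x)).
    { rewrite (Rabs_minus_sym y x).
      replace (x - IZR j) with ((y - IZR j) + (x - y)) by ring; apply Rabs_triang. }
    nra.
Qed.

(** Dirichlet's argument: (M + 1)^3 coefficient vectors give fractional parts in M^3 intervals of
    length M^-3. Two in the same interval are subtracted, and [m0] collects the integer parts. *)
Lemma small_linear_form (a1 a2 a3 : R) (M : nat) :
  (1 <= M)%nat ->
  exists m0 m1 m2 m3 : Z,
    (m1 <> 0 \/ m2 <> 0 \/ m3 <> 0)%Z /\
    Rabs (IZR m1) <= INR M /\ Rabs (IZR m2) <= INR M /\ Rabs (IZR m3) <= INR M /\
    Rabs (IZR m0 + IZR m1 * a1 + IZR m2 * a2 + IZR m3 * a3) < 1 / INR M ^ 3.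
Proof.
  intros HM.
  assert (HM0 : 0 < INR M) by (apply lt_0_INR; lia).
  set (K := INR M ^ 3); assert (HK : 0 < K) by now apply pow_lt.
  set (g := fun x : Z * Z * Z => IZR (fst (fst x)) * a1 + IZR (snd (fst x)) * a2 + IZR (snd x) * a3).
  destruct (pigeonhole (fun x => Zfloor (K * (g x - IZR (Zfloor (g x)))))
              (grid (S M)) (zrange (M * M * M))) as (x & y & Hx & Hy & Hxy & E).
  - apply NoDup_grid.
  - intros z Hz; apply in_map_iff in Hz as (x & <- & _); apply in_zrange.
    pose proof (Zfloor_bound (g x)) as Hf.
    set (t := g x - IZR (Zfloor (g x))).
    pose proof (Zfloor_bound (K * t)) as Hg.
    split; [apply Zfloor_lub; apply Rmult_le_pos; unfold t; lra|].
    apply lt_IZR; rewrite <- INR_IZR_INZ, !mult_INR.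
    apply Rle_lt_trans with (K * t); [lra|].
    apply Rlt_le_trans with (K * 1); [apply Rmult_lt_compat_l; unfold t; lra|].
    unfold K; simpl; lra.
  - rewrite length_zrange, length_grid; nia.
  - destruct x as [[x1 x2] x3], y as [[y1 y2] y3].
    apply in_grid in Hx, Hy.
    set (f1 := Zfloor (g (x1, x2, x3))) in *; set (f2 := Zfloor (g (y1, y2, y3))) in *.
    exists (f2 - f1)%Z, (x1 - y1)%Z, (x2 - y2)%Z, (x3 - y3)%Z.
    assert (B : forall a b, (0 <= a < Z.of_nat (S M))%Z -> (0 <= b < Z.of_nat (S M))%Z ->
              Rabs (IZR (a - b)) <= INR M).
    { intros a b Ha Hb; rewrite <- abs_IZR, INR_IZR_INZ; apply IZR_le; lia. }
    split; [|split; [|split; [|split]]]; try (apply B; tauto).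
    + destruct (Z.eq_dec x1 y1), (Z.eq_dec x2 y2), (Z.eq_dec x3 y3); try lia.
      subst; contradiction.
    + rewrite !minus_IZR.
      replace (IZR f2 - IZR f1 + (IZR x1 - IZR y1) * a1 + (IZR x2 - IZR y2) * a2
               + (IZR x3 - IZR y3) * a3)
        with ((g (x1, x2, x3) - IZR f1) - (g (y1, y2, y3) - IZR f2))
        by (unfold g; simpl; ring).
      set (t := g (x1, x2, x3) - IZR f1) in *; set (t' := g (y1, y2, y3) - IZR f2) in *.
      pose proof (Zfloor_bound (K * t)) as G1; pose proof (Zfloor_bound (K * t')) as G2.
      rewrite E in G1.
      apply (Rmult_lt_reg_l K); [exact HK|].
      replace (K * (1 / K)) with 1 by (field; lra).
      rewrite <- (Rabs_pos_eq K) at 1 by lra; rewrite <- Rabs_mult.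
      apply Rabs_def1; lra.
Qed.

(** The substitution r = Q^(1/3) removes the real powers; q <= n - 1 < sigma r^3 gives the bound on
    [q]. *)
Lemma DI_of_cube_root (sigma a1 a2 a3 R0 : R) :
  1 <= R0 ->
  (forall r : R, R0 <= r -> exists (n : nat) (q p1 p2 p3 : Z),
     INR n < sigma * r ^ 3 + 1 /\ (1 <= q < Z.of_nat n)%Z /\
     Rabs (IZR q * a1 - IZR p1) < sigma / r /\
     Rabs (IZR q * a2 - IZR p2) < sigma / r /\
     Rabs (IZR q * a3 - IZR p3) < sigma / r) ->
  DI sigma ((a1, a2), a3).
Proof.
  intros HR0 H; exists (R0 ^ 3); intros Q HQ HQ0.
  set (r := Rpower Q (1 / 3)).
  assert (Hr : 0 < r) by apply exp_pos.
  assert (Er : r ^ 3 = Q).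
  { unfold r; rewrite <- Rpower_pow by exact Hr; unfold r.
    rewrite Rpower_mult; replace (1 / 3 * INR 3) with 1 by (simpl; field).
    now apply Rpower_1. }
  assert (Er' : Rpower Q (- (1 / 3)) = / r) by apply Rpower_Ropp.
  assert (HrR : R0 <= r).
  { apply Rnot_lt_le; intros Hlt.
    assert (r * r < R0 * R0) by nra; simpl in HQ, Er; nra. }
  destruct (H r HrR) as (n & q & p1 & p2 & p3 & Hn & Hq & H1 & H2 & H3).
  assert (Eq : INR (Z.to_nat q) = IZR q) by (rewrite INR_IZR_INZ, Z2Nat.id by lia; reflexivity).
  exists (Z.to_nat q), (p1, p2, p3); repeat split.
  - lia.
  - unfold approx_err, supnorm, v1, v2, v3; simpl; rewrite Eq, Er'.
    repeat apply Rmax_lub_lt; assumption.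
  - rewrite Eq, <- Er.
    assert (IZR q <= INR n - 1); [|lra].
    rewrite INR_IZR_INZ, <- minus_IZR; apply IZR_le; lia.
Qed.

Lemma DI_eigenline (s : R) :
  exists sigma : R, 0 < sigma < 1 /\ DI sigma ((sqrt 2, s), sqrt 2 * s).
Proof.
  assert (S2 : sqrt 2 * sqrt 2 = 2) by (apply sqrt_sqrt; lra).
  assert (S0 : 1.4 < sqrt 2 < 1.5) by (pose proof (sqrt_pos 2); split; nra).
  pose proof (Rabs_pos s) as Hs.
  (* [C * INR M] will bound all entries of the small form and of its image under the transposed
     matrix. *)
  set (C := 3 * (1 + Rabs s)).
  assert (HC : 3 <= C) by (unfold C; lra).
  (* From n <= 2 r^3, r <= 4 C M and |th| <= M^-3 follows n |th| <= B / 2; the outer 2 covers the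
     factor [sqrt 2]. *)
  set (B := 2 * (2 * (4 * C) ^ 3)).
  assert (HB : 0 < B) by (unfold B; pose proof (pow_lt (4 * C) 3); lra).
  set (eta := 1 / (9 * B + 9)).
  assert (Heta : 0 < eta <= 1 / 2).
  { unfold eta; split; [apply Rdiv_lt_0_compat; lra|].
    apply Rmult_le_compat_l; [lra|]; apply Rinv_le_contravar; lra. }
  set (h := eta / (2 * (B + 1))).
  assert (Hh : 0 < h <= 1).
  { assert (h * (2 * (B + 1)) = eta) by (unfold h; field; lra). split; nra. }
  (* Since n (sigma / r)^3 >= sigma^4, the volume condition follows from sigma^4 (1 + h / 256) > 1.
     With x = h / 2048 this reads (1 - x)^4 (1 + 8 x) > 1. *)
  set (sigma := 1 - h / 2048).
  assert (Hsig : 0 < sigma < 1) by (unfold sigma; lra).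
  assert (Hsig4 : 1 < sigma ^ 4 * (1 + h / 256)).
  { set (x := h / 2048).
    assert (Hx : 0 < x <= 1 / 2048) by (unfold x; lra).
    replace (h / 256) with (8 * x) by (unfold x; field).
    assert (1 - 4 * x <= sigma ^ 4).
    { unfold sigma; fold x. assert (1 - 2 * x <= (1 - x) ^ 2) by nra.
      replace ((1 - x) ^ 4) with ((1 - x) ^ 2 * (1 - x) ^ 2) by ring. nra. }
    nra. }
  exists sigma; split; [exact Hsig|].
  apply (DI_of_cube_root sigma _ _ _ (4 * C)); [lra|].
  intros r Hr.
  (* The ceiling of [sigma * r ^ 3]. *)
  set (n := Z.to_nat (- Zfloor (- (sigma * r ^ 3)))).
  pose proof (Zfloor_bound (- (sigma * r ^ 3))) as Hf.
  assert (Hr3 : 1 <= r ^ 3) by (apply pow_R1_Rle; lra).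
  assert (Hsr : 0 < sigma * r ^ 3) by (apply Rmult_lt_0_compat; lra).
  assert (Hn : sigma * r ^ 3 <= INR n < sigma * r ^ 3 + 1).
  { unfold n; rewrite INR_IZR_INZ, Z2Nat.id, opp_IZR; [lra|].
    apply le_IZR; rewrite opp_IZR; lra. }
  assert (Hn2 : INR n <= 2 * r ^ 3) by nra.
  (* The largest [M] with C M <= r / 2, so that entries up to C M satisfy the size condition for d =
     sigma / r. *)
  set (M := Z.to_nat (Zfloor (r / (2 * C)))).
  pose proof (Zfloor_bound (r / (2 * C))) as Hg.
  assert (Hrc : r / (2 * C) * (2 * C) = r) by (field; lra).
  assert (Hrc2 : 2 <= r / (2 * C)) by nra.
  assert (HM : INR M = IZR (Zfloor (r / (2 * C)))).
  { unfold M; rewrite INR_IZR_INZ, Z2Nat.id; [reflexivity|]. apply Zfloor_lub; lra. }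
  rewrite <- HM in Hg.
  assert (HM2 : (2 <= M)%nat).
  { unfold M. assert (2 <= Zfloor (r / (2 * C)))%Z by (apply Zfloor_lub; lra). lia. }
  assert (HM2' : 2 <= INR M) by (apply (le_INR 2); lia).
  assert (HMr : r <= 4 * C * INR M) by nra.
  destruct (small_linear_form (sqrt 2) s (sqrt 2 * s) M) as
    (m0 & m1 & m2 & m3 & Hm & B1 & B2 & B3 & Hth); [lia|].
  set (th := IZR m0 + IZR m1 * sqrt 2 + IZR m2 * s + IZR m3 * (sqrt 2 * s)) in *.
  assert (HM3 : 8 <= INR M ^ 3).
  { replace 8 with (2 ^ 3) by ring; apply pow_incr; lra. }
  assert (Hth8 : Rabs th < 1 / 8).
  { eapply Rlt_le_trans; [exact Hth|].
    apply Rmult_le_compat_l; [lra|]; apply Rinv_le_contravar; lra. }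
  assert (HrM : r ^ 3 <= (4 * C) ^ 3 * INR M ^ 3).
  { rewrite <- Rpow_mult_distr; apply pow_incr; lra. }
  assert (HnB : Rabs (INR n * th) <= B / 2).
  { rewrite Rabs_mult, (Rabs_pos_eq (INR n)) by apply pos_INR.
    assert (Hth' : Rabs th * INR M ^ 3 <= 1).
    { apply Rmult_le_reg_r with (/ INR M ^ 3); [apply Rinv_0_lt_compat; lra|].
      rewrite Rmult_assoc, Rinv_r, Rmult_1_r by lra. unfold Rdiv in Hth; lra. }
    pose proof (Rabs_pos th).
    assert (0 < (4 * C) ^ 3) by (apply pow_lt; lra).
    apply Rle_trans with (2 * ((4 * C) ^ 3 * INR M ^ 3) * Rabs th).
    - apply Rmult_le_compat_r; lra.
    - unfold B; nra. }
  assert (HnB2 : Rabs (sqrt 2 * (INR n * th)) <= B).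
  { rewrite Rabs_mult, (Rabs_pos_eq (sqrt 2)) by lra. nra. }
  assert (Hd : 0 < sigma / r) by (apply Rdiv_lt_0_compat; lra).
  assert (Hsize : forall m : Z, Rabs (IZR m) <= C * INR M -> 2 * Rabs (IZR m) * (sigma / r) <= 1).
  { intros m Hm'. apply (Rmult_le_reg_r r); [lra|].
    replace (2 * Rabs (IZR m) * (sigma / r) * r) with (2 * Rabs (IZR m) * sigma) by (field; lra).
    pose proof (Rabs_pos (IZR m)). nra. }
  assert (Hvol : 1 < INR n * (sigma / r) ^ 3 * (1 + h / 256)).
  { apply Rlt_le_trans with (1 := Hsig4); apply Rmult_le_compat_r; [lra|].
    replace (sigma ^ 4) with (sigma * r ^ 3 * (sigma / r) ^ 3) by (field; lra).
    apply Rmult_le_compat_r; [apply pow_le; lra|lra]. }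
  assert (Hm0 : Rabs (IZR m0) <= C * INR M).
  { replace (IZR m0) with (th + (- (IZR m1 * sqrt 2) + (- (IZR m2 * s) + - (IZR m3 * (sqrt 2 * s)))))
      by (unfold th; ring).
    eapply Rle_trans; [apply Rabs_triang|].
    eapply Rle_trans; [apply Rplus_le_compat_l, Rabs_triang|].
    eapply Rle_trans; [apply Rplus_le_compat_l, Rplus_le_compat_l, Rabs_triang|].
    rewrite !Rabs_Ropp, !Rabs_mult, (Rabs_pos_eq (sqrt 2)) by lra.
    assert (Rabs (IZR m1) * sqrt 2 <= INR M * 1.5).
    { apply Rmult_le_compat; try apply Rabs_pos; lra. }
    assert (Rabs (IZR m2) * Rabs s <= INR M * Rabs s).
    { apply Rmult_le_compat_r; lra. }
    assert (Rabs (IZR m3) * (sqrt 2 * Rabs s) <= INR M * (1.5 * Rabs s)).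
    { apply Rmult_le_compat; try apply Rabs_pos; nra. }
    unfold C; nra. }
  assert (H2 : forall m : Z, Rabs (IZR m) <= INR M -> Rabs (IZR (2 * m)) <= C * INR M).
  { intros m Hm'; rewrite mult_IZR, Rabs_mult, (Rabs_pos_eq 2) by lra. nra. }
  assert (H1 : forall m : Z, Rabs (IZR m) <= INR M -> Rabs (IZR m) <= C * INR M).
  { intros m Hm'; nra. }
  (* Whichever of n th and sqrt 2 n th avoids the nonzero integers decides between the form and its
     image. *)
  destruct (sqrt2_not_near_integers (INR n * th) B) as [Hfar|Hfar]; [lra| |]; fold eta in Hfar.
  - destruct (simultaneous_approx (sqrt 2) s (sqrt 2 * s) n m0 m1 m2 m3 (sigma / r) h (eta / 2))
      as (q & p1 & p2 & p3 & Hq & E); fold th; auto; try lra.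
    + intros x Hx; apply (Rabs_sin_PI_ge_far (INR n * th)); auto; lra.
    + exists n, q, p1, p2, p3; split; [lra|tauto].
  (* The transposed matrix sends [(m0, m1, m2, m3)] to [(2 * m1, m0, 2 * m3, m2)]. *)
  - assert (Eth : IZR (2 * m1) + IZR m0 * sqrt 2 + IZR (2 * m3) * s + IZR m2 * (sqrt 2 * s)
                  = sqrt 2 * th).
    { unfold th; rewrite !mult_IZR; clear - S2; revert S2; generalize (sqrt 2); intros x X; ring [X]. }
    destruct (simultaneous_approx (sqrt 2) s (sqrt 2 * s) n (2 * m1) m0 (2 * m3) m2 (sigma / r) h (eta / 2))
      as (q & p1 & p2 & p3 & Hq & E); rewrite ?Eth; auto; try lra.
    (* If the image had only a constant term, [th] would be m1 sqrt 2 with m1 nonzero, which is too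
       large. *)
    + destruct (Z.eq_dec m0 0) as [E0|]; [|now left].
      destruct (Z.eq_dec m2 0) as [E2|]; [|lia].
      destruct (Z.eq_dec m3 0) as [E3|]; [|lia].
      exfalso; assert (Hm1 : (1 <= Z.abs m1)%Z) by lia.
      apply IZR_le in Hm1; rewrite abs_IZR in Hm1.
      replace th with (IZR m1 * sqrt 2) in Hth8 by (unfold th; rewrite E0, E2, E3; ring).
      rewrite Rabs_mult, (Rabs_pos_eq (sqrt 2)) in Hth8 by lra; nra.
    + rewrite Rabs_mult, (Rabs_pos_eq (sqrt 2)) by lra; nra.
    + replace (INR n * (sqrt 2 * th)) with (sqrt 2 * (INR n * th)) by ring.
      intros x Hx; apply (Rabs_sin_PI_ge_far (sqrt 2 * (INR n * th))); auto; lra.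
    + exists n, q, p1, p2, p3; split; [lra|tauto].
Qed.

(** * The badly approximable vector *)

(* [a * a - 3 * b * b] is the norm from Q(sqrt 2, sqrt 3) of
   [6 q + 3 sqrt 2 p1 + 2 sqrt 3 p2 + sqrt 6 p3], an element of size about [24 q] whose other
   three conjugates are small when [p] is close to [q (sqrt 2, sqrt 3, sqrt 6)]. *)
Lemma biquadratic_norm_nonzero (q p1 p2 p3 : Z) :
  let a := (36 * q * q + 12 * p2 * p2 - 18 * p1 * p1 - 6 * p3 * p3)%Z in
  let b := (24 * q * p2 - 12 * p1 * p3)%Z in
  (q <> 0 -> a * a - 3 * b * b <> 0)%Z.
Proof.
  intros a b Hq E; apply Hq.
  assert (Hb : b = 0%Z).
  { apply (square_eq_prime_mult 3 1 prime_3) with (a := a); [intros [z Hz]; lia|lia]. }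
  assert (Ha : a = 0%Z) by nia.
  (* The pairs (6 q^2, 2 p2^2) and (3 p1^2, p3^2) have equal sums and equal products, so they agree
     up to order: p1^2 = 2 q^2 or p3^2 = 6 q^2. *)
  assert (F : ((6 * q * q - 2 * p2 * p2) * (6 * q * q - 2 * p2 * p2)
               = (3 * p1 * p1 - p3 * p3) * (3 * p1 * p1 - p3 * p3))%Z).
  { unfold a, b in *.
    assert (F1 : (6 * q * q + 2 * p2 * p2 = 3 * p1 * p1 + p3 * p3)%Z) by lia.
    assert (F2 : (2 * (q * p2) = p1 * p3)%Z) by lia.
    replace ((6 * q * q - 2 * p2 * p2) * (6 * q * q - 2 * p2 * p2))%Z
      with ((6 * q * q + 2 * p2 * p2) * (6 * q * q + 2 * p2 * p2) - 12 * ((2 * (q * p2)) * (2 * (q * p2))))%Z by ring.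
    rewrite F1, F2; ring. }
  assert (F' : ((6 * q * q - 2 * p2 * p2 - (3 * p1 * p1 - p3 * p3)) *
                (6 * q * q - 2 * p2 * p2 + (3 * p1 * p1 - p3 * p3)) = 0)%Z) by lia.
  apply Z.mul_eq_0 in F' as [F'|F'].
  - apply (square_eq_prime_mult 2 1 prime_2) with (a := p1); [intros [z Hz]; lia|unfold a in Ha; lia].
  - apply (square_eq_prime_mult 2 3 prime_2) with (a := p3); [intros [z Hz]; lia|unfold a in Ha; lia].
Qed.

Lemma Rabs_lin3 (c1 c2 c3 e1 e2 e3 e : R) :
  Rabs e1 <= e -> Rabs e2 <= e -> Rabs e3 <= e ->
  Rabs (c1 * e1 + c2 * e2 + c3 * e3) <= (Rabs c1 + Rabs c2 + Rabs c3) * e.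
Proof.
  intros H1 H2 H3.
  eapply Rle_trans; [apply Rabs_triang|].
  eapply Rle_trans; [apply Rplus_le_compat_r, Rabs_triang|].
  rewrite !Rabs_mult; pose proof (Rabs_pos c1); pose proof (Rabs_pos c2);
  pose proof (Rabs_pos c3); nra.
Qed.

(** If [e] were below q^(-1/3) / 50, the norm would have modulus at most 25 q (11 e)^3 < 25 * 11^3 /
    50^3 < 1, though it is a nonzero integer. *)
Lemma badly_approximable_sqrt : badly_approximable ((sqrt 2, sqrt 3), sqrt 2 * sqrt 3).
Proof.
  set (x := sqrt 2); set (y := sqrt 3).
  assert (X : x * x = 2) by (apply sqrt_sqrt; lra).
  assert (Y : y * y = 3) by (apply sqrt_sqrt; lra).
  assert (X0 : 1.4 < x < 1.5) by (pose proof (sqrt_pos 2); fold x in H; split; nra).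
  assert (Y0 : 1.7 < y < 1.8) by (pose proof (sqrt_pos 3); fold y in H; split; nra).
  exists (1 / 50); split; [lra|].
  intros q [[p1 p2] p3] Hq.
  set (e := approx_err q (x, y, x * y) (p1, p2, p3)).
  assert (Hq1 : 1 <= INR q) by (apply (le_INR 1); lia).
  set (t := Rpower (INR q) (- (1 / 3))).
  assert (Ht : 0 < t) by apply exp_pos.
  assert (Et : t ^ 3 * INR q = 1).
  { unfold t; rewrite <- Rpower_pow by exact Ht; unfold t; rewrite Rpower_mult.
    replace (- (1 / 3) * INR 3) with (Ropp 1) by (simpl; field).
    rewrite Rpower_Ropp, Rpower_1 by lra; field; lra. }
  apply Rnot_lt_le; intros Hlt.
  set (e1 := INR q * x - IZR p1); set (e2 := INR q * y - IZR p2);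
  set (e3 := INR q * (x * y) - IZR p3).
  assert (E1 : Rabs e1 <= e) by apply Rmax_l.
  assert (E2 : Rabs e2 <= e) by (eapply Rle_trans; [apply Rmax_l|apply Rmax_r]).
  assert (E3 : Rabs e3 <= e) by (eapply Rle_trans; [apply Rmax_r|apply Rmax_r]).
  assert (He0 : 0 <= e) by (eapply Rle_trans; [apply Rabs_pos|exact E1]).
  assert (Ht1 : t <= 1).
  { apply Rnot_lt_le; intros H. assert (1 < t ^ 3) by (apply Rlt_pow_R1; lra || lia). nra. }
  assert (Hxy : 2.3 < x * y < 2.7) by nra.
  assert (G : forall c1 c2 c3, Rabs c1 + Rabs c2 + Rabs c3 = 3 * x + 2 * y + x * y ->
            Rabs (c1 * e1 + c2 * e2 + c3 * e3) <= 11 * e).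
  { intros c1 c2 c3 Hc; eapply Rle_trans; [apply (Rabs_lin3 _ _ _ _ _ _ e); assumption|].
    apply Rmult_le_compat_r; lra. }
  assert (Ax : Rabs (3 * x) = 3 * x) by (apply Rabs_pos_eq; lra).
  assert (Ay : Rabs (2 * y) = 2 * y) by (apply Rabs_pos_eq; lra).
  assert (Axy : Rabs (x * y) = x * y) by (apply Rabs_pos_eq; lra).
  pose proof (G (3 * x) (2 * y) (x * y)) as G0; rewrite Ax, Ay, Axy in G0.
  pose proof (G (3 * x) (- (2 * y)) (x * y)) as G1; rewrite Rabs_Ropp, Ax, Ay, Axy in G1.
  pose proof (G (- (3 * x)) (2 * y) (x * y)) as G2; rewrite Rabs_Ropp, Ax, Ay, Axy in G2.
  pose proof (G (3 * x) (2 * y) (- (x * y))) as G3; rewrite Rabs_Ropp, Ax, Ay, Axy in G3.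
  specialize (G0 eq_refl); specialize (G1 eq_refl); specialize (G2 eq_refl); specialize (G3 eq_refl).
  (* 24 q - f0 is the element whose norm is taken; [f1], [f2], [f3] are its conjugates under a
     change of sign of [x], of [y], and of both. *)
  set (f0 := 3 * x * e1 + 2 * y * e2 + x * y * e3) in *.
  set (f1 := 3 * x * e1 + - (2 * y) * e2 + x * y * e3) in *.
  set (f2 := - (3 * x) * e1 + 2 * y * e2 + x * y * e3) in *.
  set (f3 := 3 * x * e1 + 2 * y * e2 + - (x * y) * e3) in *.
  set (zq := Z.of_nat q).
  pose proof (biquadratic_norm_nonzero zq p1 p2 p3) as N; cbv zeta in N.
  assert (Hzq : zq <> 0%Z) by (unfold zq; lia).
  specialize (N Hzq).
  set (a := (36 * zq * zq + 12 * p2 * p2 - 18 * p1 * p1 - 6 * p3 * p3)%Z) in *.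
  set (b := (24 * zq * p2 - 12 * p1 * p3)%Z) in *.
  assert (N1 : 1 <= Rabs (IZR a * IZR a - 3 * IZR b * IZR b)).
  { rewrite <- !mult_IZR, <- minus_IZR, <- abs_IZR; apply IZR_le; lia. }
  assert (EN : IZR a * IZR a - 3 * IZR b * IZR b = (24 * INR q - f0) * f1 * f2 * f3).
  { unfold a, b, f0, f1, f2, f3, e1, e2, e3, zq.
    rewrite !minus_IZR, !plus_IZR, !mult_IZR, <- INR_IZR_INZ.
    generalize (INR q) (IZR p1) (IZR p2) (IZR p3); intros u w1 w2 w3.
    clearbody x y; clear - X Y; ring [X Y]. }
  rewrite EN, !Rabs_mult in N1.
  assert (Rabs (24 * INR q - f0) <= 25 * INR q).
  { unfold Rminus; eapply Rle_trans; [apply Rabs_triang|].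
    rewrite Rabs_Ropp, Rabs_pos_eq by lra. nra. }
  assert (Rabs (24 * INR q - f0) * Rabs f1 * Rabs f2 * Rabs f3
          <= 25 * INR q * (11 * e) * (11 * e) * (11 * e)).
  { repeat (apply Rmult_le_compat; [repeat apply Rmult_le_pos; apply Rabs_pos|apply Rabs_pos| |assumption]).
    assumption. }
  assert (e ^ 3 <= (1 / 50 * t) ^ 3) by (apply pow_incr; lra).
  assert (e ^ 3 * INR q <= (1 / 50 * t) ^ 3 * INR q) by (apply Rmult_le_compat_r; lra).
  replace ((1 / 50 * t) ^ 3 * INR q) with ((1 / 50) ^ 3 * (t ^ 3 * INR q)) in * by ring.
  rewrite Et in *. simpl in *. lra.
Qed.

(** * The segment *)

Theorem theorem5p1 :
  exists a b : vec3, a <> b /\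
    (exists v : vec3, in_segment a b v /\ badly_approximable v) /\
    (forall v : vec3, in_segment a b v ->
       exists sigma : R, 0 < sigma < 1 /\ DI sigma v).
Proof.
  assert (P : forall t, segment_point (sqrt 2, 0, 0) (sqrt 2, 2, sqrt 2 * 2) t
                        = (sqrt 2, 2 * t, sqrt 2 * (2 * t))).
  { intros t; unfold segment_point, v1, v2, v3; simpl.
    f_equal; [f_equal|]; ring. }
  (* The parameter s runs over [0, 2], which contains [sqrt 3]. *)
  exists (sqrt 2, 0, 0), (sqrt 2, 2, sqrt 2 * 2); repeat split.
  - intros E; injection E; lra.
  - exists (sqrt 2, sqrt 3, sqrt 2 * sqrt 3); split; [|exact badly_approximable_sqrt].
    exists (sqrt 3 / 2); split.
    + assert (sqrt 3 * sqrt 3 = 3) by (apply sqrt_sqrt; lra).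
      pose proof (sqrt_pos 3); split; nra.
    + rewrite P; replace (2 * (sqrt 3 / 2)) with (sqrt 3) by field; reflexivity.
  - intros v (t & _ & ->); rewrite P; apply DI_eigenline.
Qed.
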